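(* Let $q$ be a prime power, let $d>k\ge 1$ be integers, and let $\Gamma\subseteq G(d,k)$, where $G(d,k)$ denotes the set of all $k$-dimensional linear subspaces of $\mathbb{F}_q^d$. Suppose $K\subseteq\mathbb{F}_q^d$ is such that for every $V\in\Gamma$ there exists $u\in\mathbb{F}_q^d$ with $u+V\subseteq K$. Then there exists a probability measure $\mu$ on $K$ satisfying \[ |\widehat\mu(\xi)|\le |\Gamma|^{-1}\,|G(d-1,k)|\le q^{-k}\,\frac{|G(d,k)|}{|\Gamma|} \] for all non-zero $\xi\in\mathbb{F}_q^d$. In particular, $|K|\gtrsim \min\{q^d,\ |\Gamma|^2 q^{-2k(d-k-1)}\}$.
   Context: $\mathbb{F}_q$ is the finite field with $q$ elements and $\mathbb{F}_q^d$ the $d$-dimensional vector space over it, with the standard dot product $\xi\cdot x\in\mathbb{F}_q$. Fix a non-trivial additive character $\chi:\mathbb{F}_q\to S^1\subseteq\mathbb{C}$. The Fourier transform of $f:\mathbb{F}_q^d\to\mathbb{C}$ is $\widehat f(\xi)=\sum_{x\in\mathbb{F}_q^d}\chi(-\xi\cdot x)f(x)$. A probability measure on $\mathbb{F}_q^d$ is a non-negative real-valued function summing to $1$; a probability measure on $K$ means one whose support $\{x:\mu(x)>0\}$ is contained in $K$. $G(d-1,k)$ denotes the set of $k$-dimensional subspaces of $\mathbb{F}_q^{d-1}$. $A\gtrsim B$ means $A\ge cB$ for a constant $c>0$ independent of $q$. *)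

(* Defs.v *)
From HB Require Import structures.
From mathcomp Require Import all_boot all_order all_algebra all_field.
From mathcomp Require Import reals.
From mathcomp Require Import complex.
Set Implicit Arguments.
Unset Strict Implicit.
Unset Printing Implicit Defensive.
Import Order.TTheory GRing.Theory Num.Theory.
Local Open Scope ring_scope.
Local Open Scope complex_scope.

(* A subspace is stored as a canonical matrix, so a finite scalar field gives
   finitely many subspaces. *)
HB.instance Definition _ (F : finFieldType) (vT : vectType F) :
    isCountable {vspace vT} :=
  CanIsCountable (@VectorInternalTheory.vs2mxK F vT).
HB.instance Definition _ (F : finFieldType) (vT : vectType F) :
    isFinite {vspace vT} :=
  CanIsFinite (@VectorInternalTheory.vs2mxK F vT).

Definition grassmannian (F : finFieldType) (d k : nat) :
    {set {vspace 'rV[F]_d}} :=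
  [set V : {vspace 'rV[F]_d} | \dim V == k].

Definition dotv (F : finFieldType) (d : nat) (xi x : 'rV[F]_d) : F :=
  \sum_(i < d) xi 0 i * x 0 i.

Definition nontrivial_additive_character (R : realType) (F : finFieldType)
    (chi : F -> R[i]) : Prop :=
  [/\ forall a : F, `|chi a| = 1 :> R[i],
      forall a b : F, chi (a + b) = chi a * chi b
    & exists a : F, chi a != 1].

Definition fourier (R : realType) (F : finFieldType) (chi : F -> R[i])
    (d : nat) (f : 'rV[F]_d -> R[i]) (xi : 'rV[F]_d) : R[i] :=
  \sum_(x : 'rV[F]_d) chi (- dotv xi x) * f x.

Definition probability_measure_on (R : realType) (F : finFieldType) (d : nat)
    (K : {set 'rV[F]_d}) (mu : 'rV[F]_d -> R) : Prop :=
  [/\ forall x, 0 <= mu x,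
      \sum_(x : 'rV[F]_d) mu x = 1
    & forall x, 0 < mu x -> x \in K].

Definition contains_translates (F : finFieldType) (d : nat)
    (Gamma : {set {vspace 'rV[F]_d}}) (K : {set 'rV[F]_d}) : Prop :=
  forall V : {vspace 'rV[F]_d}, V \in Gamma ->
    exists u : 'rV[F]_d, forall v : 'rV[F]_d, v \in V -> u + v \in K.

(* Main.v *)
Require Import Defs.
From HB Require Import structures.
From mathcomp Require Import all_boot all_order all_algebra all_field.
From mathcomp Require Import reals.
From mathcomp Require Import complex.
From mathcomp Require Import zify ring lra.
Set Implicit Arguments.
Unset Strict Implicit.
Unset Printing Implicit Defensive.
Import Order.TTheory GRing.Theory Num.Theory.
Local Open Scope ring_scope.
Local Open Scope complex_scope.

(* Take mu to be the average over V in Gamma of the uniform probability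
   measures on translates u_V + V contained in K. Any function g on F of mean
   zero satisfies sum_(v in V) g(c + xi.v) = 0 unless V is orthogonal to xi, so
   only the at most |G(d-1,k)| subspaces inside the hyperplane orthogonal to xi
   contribute to sum_x g(c + xi.x) mu(x). With g a character this is the Fourier
   decay. With g(a) = q [a = 0] - 1, the sum of all nontrivial characters of F,
   it bounds the sum of mu^2 without needing the existence of a character, and
   Cauchy-Schwarz turns this into a lower bound for |K|. *)

(** * The dot product and orthogonality to a subspace *)

Lemma dotvC (F : finFieldType) (d : nat) (x y : 'rV[F]_d) :
  dotv x y = dotv y x.
Proof. by apply: eq_bigr => i _; rewrite mulrC. Qed.

Lemma dotvD (F : finFieldType) (d : nat) (xi x y : 'rV[F]_d) :
  dotv xi (x + y) = dotv xi x + dotv xi y.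
Proof. by rewrite -big_split; apply: eq_bigr => i _; rewrite mxE mulrDr. Qed.

Lemma dotvZ (F : finFieldType) (d : nat) (xi x : 'rV[F]_d) (c : F) :
  dotv xi (c *: x) = c * dotv xi x.
Proof. by rewrite mulr_sumr; apply: eq_bigr => i _; rewrite mxE mulrCA. Qed.

Lemma dotvB (F : finFieldType) (d : nat) (xi x y : 'rV[F]_d) :
  dotv xi (x - y) = dotv xi x - dotv xi y.
Proof. by rewrite dotvD -scaleN1r dotvZ mulN1r. Qed.

Lemma dotv_delta (F : finFieldType) (d : nat) (xi : 'rV[F]_d) (i : 'I_d) :
  dotv xi (delta_mx 0 i) = xi 0 i.
Proof.
rewrite /dotv (bigD1 i) //= mxE !eqxx mulr1 big1 ?addr0 // => j ji.
by rewrite mxE (negPf ji) andbF mulr0.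
Qed.

Lemma exists_dotv_neq0 (F : finFieldType) (d : nat) (xi : 'rV[F]_d) :
  xi != 0 -> exists x, dotv xi x != 0.
Proof.
move=> /rV0Pn[i xi_i].
by exists (delta_mx 0 i); rewrite dotv_delta.
Qed.

Definition perp (F : finFieldType) (d : nat) (xi : 'rV[F]_d)
    (V : {vspace 'rV[F]_d}) : bool :=
  [forall (v | v \in V), dotv xi v == 0].

Lemma perpP (F : finFieldType) (d : nat) (xi : 'rV[F]_d)
    (V : {vspace 'rV[F]_d}) :
  reflect (forall v, v \in V -> dotv xi v = 0) (perp xi V).
Proof. by apply: (iffP forall_inP) => h v /h /eqP. Qed.

(* Shifting v by multiples of a vector of V not orthogonal to xi shows that
   the sum does not depend on c. *)
Lemma sum_dotv_eq0 (S : numDomainType) (F : finFieldType) (d : nat)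
    (xi : 'rV[F]_d) (V : {vspace 'rV[F]_d}) (g : F -> S) (c : F) :
  \sum_a g a = 0 -> ~~ perp xi V -> \sum_(v in V) g (c + dotv xi v) = 0.
Proof.
move=> g0 /forall_inPn[w wV xiw].
have indep c' : \sum_(v in V) g (c' + dotv xi v) =
                \sum_(v in V) g (c + dotv xi v).
  pose s := (c - c') / dotv xi w.
  rewrite (reindex_inj (addIr (s *: w))) /=; apply: eq_big => v.
    by rewrite rpredDr // memvZ.
  by rewrite dotvD dotvZ divfK // addrCA [c' + _]addrC subrK addrC.
(* Summing over all [c'] gives zero because [g] has mean zero; by independence of [c'] it is also q
   times the common value. *)
apply/eqP; have : \sum_c' \sum_(v in V) g (c' + dotv xi v) == 0.
  rewrite exchange_big /=; apply/eqP/big1 => v _.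
  by rewrite -[RHS]g0 [RHS](reindex_inj (addIr (dotv xi v))).
rewrite (eq_bigr _ (fun c' _ => indep c')) sumr_const -mulr_natr mulf_eq0.
by rewrite pnatr_eq0 gtn_eqF ?orbF //; apply/card_gt0P; exists 0.
Qed.

(** * Counting subspaces *)

(** On the hyperplane orthogonal to [xi], a coordinate [j] with [xi 0 j != 0] is determined by the
    others. Deleting it is injective there, so it maps distinct subspaces to distinct subspaces of
    the same dimension. *)
Lemma card_perp_grassmannian (F : finFieldType) (n k : nat)
    (xi : 'rV[F]_n.+1) : xi != 0 ->
  (#|[set V in grassmannian F n.+1 k | perp xi V]| <= #|grassmannian F n k|)%N.
Proof.
move=> /rV0Pn[j xij].
pose f : 'Hom('rV[F]_n.+1, 'rV[F]_n) := linfun (col' j).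
have f0 x : dotv xi x = 0 -> f x = 0 -> x = 0.
  rewrite lfunE /= => xix /rowP x'0.
  have xi0 i : i != j -> x 0 i = 0.
    by case: (unliftP j i) => [i' -> _|->];
      [have := x'0 i'; rewrite !mxE | rewrite eqxx].
  apply/rowP => i; rewrite mxE; have [->|/xi0//] := eqVneq i j.
  move: xix; rewrite /dotv (bigD1 j) //= big1 => [|i' /xi0 ->];
    last by rewrite mulr0.
  by rewrite addr0 => /eqP; rewrite mulf_eq0 (negPf xij) => /eqP.
have sub V W : perp xi V -> perp xi W -> (f @: V = f @: W)%VS -> (V <= W)%VS.
  move=> /perpP Vp /perpP Wp fVW; apply/subvP => v vV.
  have /memv_imgP[w wW fvw] : f v \in (f @: W)%VS by rewrite -fVW memv_img.
  suff /eqP : v - w = 0 by rewrite subr_eq0 => /eqP ->.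
  by apply: f0; rewrite ?dotvB ?linearB /= ?fvw ?subrr // Vp // Wp // subrr.
rewrite -(@card_in_imset _ _ (fun V => f @: V)%VS); last first.
  move=> V W /[!inE]/andP[_ Vp] /andP[_ Wp] fVW.
  by apply/eqP; rewrite eqEsubv !sub.
apply/subset_leq_card/subsetP => _ /imsetP[V /[!inE] /andP[/eqP dV /perpP Vp] ->].
rewrite limg_dim_eq ?dV //; apply/eqP; rewrite -subv0; apply/subvP => x.
by rewrite memv_cap memv_ker memv0 => /andP[/Vp xp /eqP fx]; apply/eqP/f0.
Qed.

(* The graphs of the q ^ k linear functionals on a k-dimensional subspace of
   F^n are k-dimensional subspaces of F^(n+1). *)
Lemma card_grassmannian_step (F : finFieldType) (n k : nat) :
  (#|grassmannian F n k| * #|F| ^ k <= #|grassmannian F n.+1 k|)%N.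
Proof.
(* The prefixed entry is the value at [x] of the functional whose values on the basis of [V] are the
   entries of [w]; when [\dim V = k] no index leaves the tuple. *)
pose phi (V : {vspace 'rV[F]_n}) (w : k.-tuple F) (x : 'rV[F]_n) : 'rV[F]_(1 + n) :=
  row_mx (\sum_(i < \dim V) w`_i * coord (vbasis V) i x)%:M x.
have phi_lin V w : linear (phi V w).
  move=> a x y; rewrite /phi scale_row_mx add_row_mx; congr row_mx.
  rewrite scale_scalar_mx -raddfD; congr (_%:M).
  rewrite mulr_sumr -big_split; apply: eq_bigr => i _.
  by rewrite linearP mulrDr mulrCA.
pose phiL V w : {linear 'rV[F]_n -> 'rV[F]_n.+1} :=
  HB.pack (phi V w) (GRing.isLinear.Build _ _ _ _ _ (phi_lin V w)).
pose G (p : {vspace 'rV[F]_n} * k.-tuple F) : {vspace 'rV[F]_n.+1} :=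
  (linfun (phiL p.1 p.2) @: p.1)%VS.
have Gmem (V : {vspace 'rV[F]_n}) w y :
    reflect (exists2 x, x \in V & y = phi V w x) (y \in G (V, w)).
  apply: (iffP memv_imgP) => -[x xV ->]; exists x => //.
    by rewrite lfunE.
  by rewrite lfunE.
have Gsub (V : {vspace 'rV[F]_n}) w (W : {vspace 'rV[F]_n}) w' :
    G (V, w) = G (W, w') -> (V <= W)%VS.
  move=> GE; apply/subvP => x xV.
  have /Gmem[y yW /eq_row_mx[_ ->]//] : phi V w x \in G (W, w').
  by rewrite -GE; apply/Gmem; exists x.
have <- : #|setX (grassmannian F n k) [set: k.-tuple F]| =
          (#|grassmannian F n k| * #|F| ^ k)%N.
  by rewrite cardsX cardsT card_tuple.
rewrite -(@card_in_imset _ _ G); last first.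
  move=> [V w] [W w'] /setXP[/[!inE]/eqP dV _] _ GE.
  have VW : V = W.
    by apply/eqP; rewrite eqEsubv (Gsub _ _ _ _ GE) (Gsub _ _ _ _ (esym GE)).
  subst W; congr pair; apply: eq_from_tnth => i.
  rewrite !(tnth_nth 0).
  have iV : (i < \dim V)%N by rewrite dV.
  (* Evaluating the functional at the [i]-th basis vector recovers the [i]-th entry of the tuple, so
     the graph determines the tuple. *)
  have coordE (u : k.-tuple F) :
      \sum_(j < \dim V) u`_j * coord (vbasis V) j (vbasis V)`_i = u`_i.
    rewrite (bigD1 (Ordinal iV)) //= (coord_free (Ordinal iV) (Ordinal iV))
      ?(basis_free (vbasisP _)) //.
    rewrite eqxx mulr1 big1 ?addr0 // => j ji.
    rewrite (coord_free (Ordinal iV) j) ?(basis_free (vbasisP _)) //.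
    by rewrite eq_sym (negPf ji) mulr0.
  have /Gmem[y _ /eq_row_mx[]] : phi V w (vbasis V)`_i \in G (V, w').
    rewrite -GE; apply/Gmem; exists (vbasis V)`_i => //.
    by rewrite vbasis_mem // mem_nth // size_tuple.
  move=> /[swap] <-; rewrite !coordE => /matrixP/(_ 0 0).
  by rewrite !mxE eqxx.
apply/subset_leq_card/subsetP => _ /imsetP[[V w] /setXP[/[!inE]/eqP dV _] ->].
have phi0 x : phi V w x = 0 -> x = 0.
  by rewrite -row_mx0 => /eq_row_mx[].
rewrite limg_dim_eq ?dV //; apply/eqP; rewrite -subv0; apply/subvP => x.
rewrite memv_cap memv_ker memv0 => /andP[_].
by rewrite lfunE => /eqP/phi0 ->.
Qed.

(** Each factor q^i - 1 in the order formula for GL_n is at least q^i / 2, since q >= 2 and i >=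
    1. *)
Lemma card_GL_lower (F : finFieldType) (n : nat) : (0 < n)%N ->
  (#|F| ^ (n * n) <= 2 ^ n * #|'GL_n[F]%g|)%N.
Proof.
move=> n0; have q1 := finNzRing_gt1 F.
have -> : (n * n = 'C(n, 2) + \sum_(1 <= i < n.+1) i)%N.
  have := bin2_sum n.+1; rewrite big_ltn // add0n => ->.
  by elim: n {n0} => // n IHn; move: IHn; rewrite !binS !bin1 bin0; lia.
rewrite expnD card_GL // mulnCA leq_mul2l expn_sum; apply/orP; right.
have -> : (2 ^ n = \prod_(1 <= i < n.+1) 2)%N.
  by rewrite prod_nat_const_nat subn1.
rewrite -big_split /= !big_nat; apply: leq_prod => i /andP[i0 _].
have qi : (1 < #|F| ^ i)%N by rewrite -(exp1n i) ltn_exp2r.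
by move: (#|F| ^ i)%N qi => m; lia.
Qed.

(** Multiplying a basis matrix of V by g in GL_k gives a k x n matrix with row space V; since the
    basis rows are independent, it then determines g. So the pairs (V, g) inject into the q^(kn)
    matrices. *)
Lemma card_grassmannian_upper (F : finFieldType) (n k : nat) : (0 < k)%N ->
  (#|grassmannian F n k| * #|F| ^ (k * k) <= 2 ^ k * #|F| ^ (k * n))%N.
Proof.
move=> k0; apply: (leq_trans (leq_mul (leqnn _) (card_GL_lower F k0))).
rewrite mulnCA leq_mul2l; apply/orP; right.
(* Matrices in ['GL_k[F]] have size [k.-1.+1], so [k] is made a successor for the sizes to agree. *)
case: k k0 => // k _.
pose B (V : {vspace 'rV[F]_n}) : 'M[F]_(k.+1, n) := \matrix_i (vbasis V)`_i.
have mulB V (y : 'rV_k.+1) : y *m B V = \sum_i y 0 i *: (vbasis V)`_i.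
  by rewrite mulmx_sum_row; apply: eq_bigr => i _; rewrite rowK.
have memB V x : \dim V = k.+1 -> (x \in V) = (x <= B V)%MS.
  move=> dV; apply/idP/submxP => [xV|[y ->]]; last first.
    rewrite mulB; apply: rpred_sum => i _; rewrite memvZ // vbasis_mem // mem_nth //.
    by rewrite size_tuple dV.
  exists (\row_i coord (vbasis V) (cast_ord (esym dV) i) x); rewrite mulB.
  rewrite [LHS](coord_vbasis xV) (reindex (cast_ord (esym dV))) /=; last first.
    by apply: onW_bij; exists (cast_ord dV); [apply: cast_ordKV|apply: cast_ordK].
  by apply: eq_bigr => i _; rewrite mxE.
have freeB V : \dim V = k.+1 -> row_free (B V).
  move=> dV; apply: inj_row_free => y; rewrite mulB => yB0.
  have /freeP/(_ (fun i => y 0 (cast_ord dV i))) := basis_free (vbasisP V).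
  have -> : \sum_(i < \dim V) y 0 (cast_ord dV i) *: (vbasis V)`_i = 0.
    rewrite -[RHS]yB0 [RHS](reindex (cast_ord dV)) //.
    by apply: onW_bij; exists (cast_ord (esym dV));
      [apply: cast_ordK|apply: cast_ordKV].
  by move=> /(_ erefl) y0; apply/rowP => i; rewrite -(cast_ordKV dV i) y0 mxE.
pose G (p : {vspace 'rV[F]_n} * {'GL_k.+1[F]}) : 'M_(k.+1, n) := GLval p.2 *m B p.1.
rewrite -cardsX -card_mx; apply: (@leq_card_in _ _ G) => -[V g] [W h].
rewrite !inE /= !andbT => /eqP dV /eqP dW; rewrite /G /= => GE.
have eqB V' (g' : {'GL_k.+1[F]}) : (GLval g' *m B V' :=: B V')%MS.
  by apply: eqmxMfull; rewrite row_full_unit; apply: GL_unitmx.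
have VW : V = W.
  by apply/vspaceP => x; rewrite !memB // -(eqB V g) -(eqB W h) GE.
subst W; congr pair; apply: val_inj; exact: row_free_inj (freeB V dV) _ _ GE.
Qed.

(** * The averaged measure and its decay *)

(** Normalised for [k]-dimensional subspaces, whose translates have q^k points. The scalars [S] are
    general because both a real and a complex version are needed. *)
Definition translate_measure (S : numFieldType) (F : finFieldType) (d k : nat)
    (Gamma : {set {vspace 'rV[F]_d}}) (u : {vspace 'rV[F]_d} -> 'rV[F]_d)
    (x : 'rV[F]_d) : S :=
  (#|Gamma|%:R * #|F|%:R ^+ k)^-1 * \sum_(V in Gamma) (x - u V \in V)%:R.

Lemma sum_translate_measure (S : numFieldType) (F : finFieldType) (d k : nat)
    (Gamma : {set {vspace 'rV[F]_d}}) (u : {vspace 'rV[F]_d} -> 'rV[F]_d)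
    (f : 'rV[F]_d -> S) :
  \sum_x f x * translate_measure S k Gamma u x =
  (#|Gamma|%:R * #|F|%:R ^+ k)^-1 *
    \sum_(V in Gamma) \sum_(v in V) f (u V + v).
Proof.
rewrite (eq_bigr (fun x => (#|Gamma|%:R * #|F|%:R ^+ k)^-1 *
    \sum_(V in Gamma) f x * (x - u V \in V)%:R)); last first.
  by move=> x _; rewrite /translate_measure mulrCA mulr_sumr.
rewrite -mulr_sumr exchange_big /=; congr (_ * _); apply: eq_bigr => V _.
rewrite (reindex_inj (addrI (u V))) [RHS]big_mkcond /=; apply: eq_bigr => v _.
by rewrite addrAC subrr add0r; case: ifP; rewrite ?mulr1 ?mulr0.
Qed.

Lemma translate_measure_ge0 (S : numFieldType) (F : finFieldType) (d k : nat)
    (Gamma : {set {vspace 'rV[F]_d}}) (u : {vspace 'rV[F]_d} -> 'rV[F]_d) x :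
  0 <= translate_measure S k Gamma u x.
Proof.
by rewrite mulr_ge0 ?invr_ge0 ?mulr_ge0 ?exprn_ge0 ?ler0n // sumr_ge0.
Qed.

Lemma sum_translate_measure1 (S : numFieldType) (F : finFieldType) (d k : nat)
    (Gamma : {set {vspace 'rV[F]_d}}) (u : {vspace 'rV[F]_d} -> 'rV[F]_d) :
  Gamma \subset grassmannian F d k -> Gamma != set0 ->
  \sum_x translate_measure S k Gamma u x = 1.
Proof.
move=> /subsetP GammaG Gamma0.
have q0 : #|F|%:R != 0 :> S by rewrite pnatr_eq0 gtn_eqF // ltnW // finNzRing_gt1.
have g0 : #|Gamma|%:R != 0 :> S by rewrite pnatr_eq0 cards_eq0.
rewrite (eq_bigr (fun x => 1 * translate_measure S k Gamma u x)); last first.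
  by move=> x _; rewrite mul1r.
rewrite sum_translate_measure (eq_bigr (fun=> #|F|%:R ^+ k)); last first.
  by move=> V /GammaG /[!inE]/eqP dV; rewrite sumr_const card_vspace dV natrX.
by rewrite sumr_const -[X in _ * X]mulr_natl mulVf // mulf_neq0 // expf_neq0.
Qed.

(** Only subspaces orthogonal to [xi] contribute, each at most B q^k, and the normalisation cancels
    q^k. The shift by [c] absorbs the translation terms [dotv xi y] met in the energy estimate. *)
Lemma translate_measure_decay (S : numFieldType) (F : finFieldType) (n k : nat)
    (Gamma : {set {vspace 'rV[F]_n.+1}})
    (u : {vspace 'rV[F]_n.+1} -> 'rV[F]_n.+1)
    (g : F -> S) (B : S) (xi : 'rV[F]_n.+1) (c : F) :
  Gamma \subset grassmannian F n.+1 k -> xi != 0 ->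
  \sum_a g a = 0 -> (forall a, `|g a| <= B) ->
  `|\sum_x g (c + dotv xi x) * translate_measure S k Gamma u x| <=
    B * (#|Gamma|%:R^-1 * #|grassmannian F n k|%:R).
Proof.
move=> GammaG xi0 g0 gB.
have B0 : 0 <= B by apply: le_trans (gB 0); rewrite normr_ge0.
have q0 : #|F|%:R != 0 :> S by rewrite pnatr_eq0 gtn_eqF // ltnW // finNzRing_gt1.
rewrite (sum_translate_measure k Gamma u (fun x => g (c + dotv xi x))).
rewrite normrM ger0_norm ?invr_ge0 ?mulr_ge0 ?exprn_ge0 ?ler0n //.
set D := _^-1.
have le_V V : V \in Gamma ->
    `|\sum_(v in V) g (c + dotv xi (u V + v))| <=
      (perp xi V)%:R * (B * #|F|%:R ^+ k).
  move=> VG; case: (boolP (perp xi V)) => [_|nperp]; last first.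
    rewrite mul0r (eq_bigr (fun v => g (c + dotv xi (u V) + dotv xi v))).
      by rewrite sum_dotv_eq0 // normr0.
    by move=> v _; rewrite dotvD addrA.
  rewrite mul1r; apply: le_trans (ler_norm_sum _ _ _) _.
  have := subsetP GammaG V VG; rewrite inE => /eqP dV.
  apply: le_trans (ler_sum _ (fun v _ => gB (c + dotv xi (u V + v)))) _.
  by rewrite sumr_const card_vspace dV -natrX mulr_natr.
have -> : B * (#|Gamma|%:R^-1 * #|grassmannian F n k|%:R) =
    D * (#|grassmannian F n k|%:R * (B * #|F|%:R ^+ k)).
  rewrite /D invfM; move: (_ ^+ k) (expf_neq0 k q0) => Q Q0.
  by move: (_^-1) => gi; field.
apply: ler_wpM2l; first by rewrite invr_ge0 mulr_ge0 ?exprn_ge0 ?ler0n.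
apply: le_trans (ler_norm_sum _ _ _) _; apply: le_trans (ler_sum _ le_V) _.
rewrite -mulr_suml ler_wpM2r ?mulr_ge0 ?exprn_ge0 ?ler0n //.
rewrite -natr_sum ler_nat; apply: leq_trans (card_perp_grassmannian k xi0).
rewrite (eq_bigr (fun V => if perp xi V then 1%N else 0%N)) => [|V _];
  last by case: perp.
rewrite -big_mkcondr sum1dep_card.
apply/subset_leq_card/subsetP => V; rewrite [V \in [set _ | _]]inE => /andP[VG Vp].
by rewrite inE Vp (subsetP GammaG).
Qed.

(** * The energy of the measure *)

(** Stands in for the nontrivial characters added together; unlike them it takes values in any [S],
    in particular in the reals. *)
Definition delta_kernel (S : numFieldType) (F : finFieldType) (a : F) : S :=
  #|F|%:R * (a == 0)%:R - 1.

Lemma sum_delta_kernel (S : numFieldType) (F : finFieldType) :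
  \sum_(a : F) delta_kernel S a = 0.
Proof.
rewrite big_split /= sumrN sumr_const -mulr_sumr (bigD1 (0 : F)) //= eqxx.
by rewrite big1 ?addr0 ?mulr1 ?subrr // => a /negPf ->.
Qed.

Lemma norm_delta_kernel (S : numFieldType) (F : finFieldType) (a : F) :
  `|delta_kernel S a| <= #|F|%:R - 1.
Proof.
have q1 := finNzRing_gt1 F; rewrite /delta_kernel; case: eqP => _.
  by rewrite mulr1 ger0_norm // subr_ge0 ler1n ltnW.
by rewrite mulr0 add0r normrN normr1 lerBrDr -[1 + 1]/(2%:R) ler_nat.
Qed.

(** Orthogonality relation: for z nonzero the whole space is not orthogonal to z, so the mean-zero
    kernel sums to 0 with the roles of frequency and point exchanged. *)
Lemma sum_delta_kernel_dotv (S : numFieldType) (F : finFieldType) (d : nat)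
    (z : 'rV[F]_d) :
  \sum_xi delta_kernel S (dotv xi z) =
    #|F|%:R ^+ d * (#|F|%:R - 1) * (z == 0)%:R.
Proof.
have [->|z0] := eqVneq z 0.
  rewrite (eq_bigr (fun=> #|F|%:R - 1)) => [|xi _].
    by rewrite sumr_const card_mx mul1n -[LHS]mulr_natl natrX mulr1.
  rewrite /dotv big1 => [|i _]; last by rewrite mxE mulr0.
  by rewrite /delta_kernel eqxx mulr1.
have g0 := sum_delta_kernel S F.
rewrite mulr0 -[RHS](@sum_dotv_eq0 S F d z fullv (@delta_kernel S F) 0 g0).
  by apply: eq_big => xi; rewrite ?memvf // add0r dotvC.
have [x xz] := exists_dotv_neq0 z0.
by apply/negP => /perpP/(_ x (memvf x))/eqP; rewrite (negPf xz).
Qed.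

(* Plancherel's identity with the characters averaged over the multiples of
   each frequency: [delta_kernel a] is the sum of chi (c * a) over c != 0. *)
Lemma delta_kernel_plancherel (S : numFieldType) (F : finFieldType) (d : nat)
    (f : 'rV[F]_d -> S) :
  \sum_xi \sum_y (\sum_x delta_kernel S (- dotv xi y + dotv xi x) * f x) * f y =
    #|F|%:R ^+ d * (#|F|%:R - 1) * \sum_x f x ^+ 2.
Proof.
rewrite exchange_big mulr_sumr; apply: eq_bigr => y _ /=.
rewrite -mulr_suml exchange_big /= expr2 mulrA; congr (_ * _).
(* For fixed [y], summing over [xi] first leaves only the diagonal term x = y. *)
rewrite (bigD1 y) //= [X in _ + X]big1 => [|x xy]; last first.
  rewrite -mulr_suml (eq_bigr (fun xi => delta_kernel S (dotv xi (x - y)))).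
    by rewrite sum_delta_kernel_dotv subr_eq0 (negPf xy) mulr0 mul0r.
  by move=> xi _; rewrite dotvB addrC.
rewrite addr0 -mulr_suml (eq_bigr (fun xi => delta_kernel S (dotv xi (y - y)))).
  by rewrite sum_delta_kernel_dotv subrr eqxx mulr1.
by move=> xi _; rewrite dotvB addrC.
Qed.

(** In the Plancherel identity the zero frequency contributes q - 1 and every other one at most (q -
    1) M^2, with M the decay bound; the factor q - 1 then cancels. *)
Lemma translate_measure_l2 (S : numFieldType) (F : finFieldType) (n k : nat)
    (Gamma : {set {vspace 'rV[F]_n.+1}})
    (u : {vspace 'rV[F]_n.+1} -> 'rV[F]_n.+1) :
  Gamma \subset grassmannian F n.+1 k -> Gamma != set0 ->
  #|F|%:R ^+ n.+1 * \sum_x translate_measure S k Gamma u x ^+ 2 <=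
  1 + #|F|%:R ^+ n.+1 * (#|Gamma|%:R^-1 * #|grassmannian F n k|%:R) ^+ 2.
Proof.
move=> GammaG Gamma0; set mu := translate_measure S k Gamma u.
have mu1 : \sum_x mu x = 1 by exact: sum_translate_measure1.
set M := _^-1 * _.
have M0 : 0 <= M by rewrite mulr_ge0 ?invr_ge0 ?ler0n.
have q1 : 0 < #|F|%:R - 1 :> S by rewrite subr_gt0 ltr1n finNzRing_gt1.
rewrite -(ler_pM2l q1) mulrA [_ * _ ^+ n.+1]mulrC -delta_kernel_plancherel.
rewrite (bigD1 0) //= mulrDr mulr1; apply: lerD.
  have dot0 x : dotv (0 : 'rV[F]_n.+1) x = 0.
    by apply: big1 => i _; rewrite mxE mul0r.
  under eq_bigr do under eq_bigr do rewrite !dot0 oppr0 addr0.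
  rewrite -mulr_sumr mu1 mulr1 -mulr_sumr mu1 mulr1.
  by rewrite /delta_kernel eqxx mulr1.
have le_xi xi : xi != 0 ->
  \sum_y (\sum_x delta_kernel S (- dotv xi y + dotv xi x) * mu x) * mu y
    <= (#|F|%:R - 1) * M ^+ 2.
  (* The inner sum depends on [y] only through a = xi.y. Decay is applied twice: to the kernel to
     bound [G], then to [G], which again has mean zero. *)
  move=> xi0; pose G a := \sum_x delta_kernel S (- a + dotv xi x) * mu x.
  have GB a : `|G a| <= (#|F|%:R - 1) * M.
    apply: translate_measure_decay => //;
      [exact: sum_delta_kernel | exact: norm_delta_kernel].
  have G0 : \sum_a G a = 0.
    rewrite exchange_big big1 // => x _; rewrite -mulr_suml.
    rewrite (reindex_inj oppr_inj) /=; under eq_bigr do rewrite opprK.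
    have -> : \sum_(a : F) delta_kernel S (a + dotv xi x) = 0.
      by rewrite -[RHS](sum_delta_kernel S F) [RHS](reindex_inj (addIr (dotv xi x))).
    by rewrite mul0r.
  (* In a general [numFieldType] only a real element is known to be at most its norm. *)
  have GR : \sum_y G (0 + dotv xi y) * mu y \is Num.real.
    have mu_real x : mu x \is Num.real by rewrite ger0_real ?translate_measure_ge0.
    apply: rpred_sum => y _; apply: realM => //; apply: rpred_sum => x _.
    by apply: realM => //; rewrite rpredB ?realM ?realn ?real1.
  have := @translate_measure_decay S F n k Gamma u G _ xi 0 GammaG xi0 G0 GB.
  rewrite -/M -mulrA -expr2; apply: le_trans.
  apply: le_trans (real_ler_norm GR); rewrite le_eqVlt; apply/orP; left.
  by apply/eqP/eq_bigr => y _; rewrite add0r.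
apply: le_trans (ler_sum _ le_xi) _.
rewrite sumr_const -[leLHS]mulr_natl mulrCA.
rewrite ler_wpM2l ?(ltW q1) // ler_wpM2r ?exprn_ge0 // -natrX ler_nat.
by rewrite -[n.+1 in leqRHS]mul1n -card_mx max_card.
Qed.

(** Cauchy-Schwarz on [K], obtained by expanding the nonnegative sum of squared deviations of [mu]
    from its mean 1/|K|. *)
Lemma inv_card_le_l2 (R : realFieldType) (T : finType) (K : {set T})
    (mu : T -> R) :
  (forall x, x \notin K -> mu x = 0) -> \sum_x mu x = 1 ->
  1 <= #|K|%:R * \sum_x mu x ^+ 2.
Proof.
move=> muK mu1.
have sumK (f : T -> R) : (forall x, mu x = 0 -> f x = 0) ->
    \sum_x f x = \sum_(x in K) f x.
  move=> f0; rewrite [RHS]big_mkcond; apply: eq_bigr => x _.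
  by case: ifPn => // /muK /f0.
rewrite (sumK (fun x => mu x ^+ 2)) => [|x ->]; last by rewrite expr0n.
rewrite (sumK mu) // in mu1.
have K0 : 0 < #|K|%:R :> R.
  rewrite ltr0n lt0n cards_eq0; apply/eqP => K0.
  by move: mu1; rewrite K0 big_set0 => /eqP; rewrite eq_sym oner_eq0.
have : 0 <= \sum_(x in K) (mu x - #|K|%:R^-1) ^+ 2.
  by apply: sumr_ge0 => x _; rewrite sqr_ge0.
under eq_bigr do rewrite sqrrB.
rewrite big_split /= sumrB sumrMnl -mulr_suml mu1 mul1r sumr_const.
rewrite -[X in _ + X]mulr_natl.
move=> /(ler_wpM2l (ltW K0)); rewrite mulr0; set s := \sum_(x in K) _.
have -> : #|K|%:R * (s - #|K|%:R^-1 *+ 2 + #|K|%:R * #|K|%:R^-1 ^+ 2) =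
    #|K|%:R * s - 1.
  by field; rewrite gt_eqF.
by rewrite subr_ge0.
Qed.

(** * Fourier decay for a character *)

Lemma rmorph_translate_measure (S S' : numFieldType) (f : {rmorphism S -> S'})
    (F : finFieldType) (d k : nat) (Gamma : {set {vspace 'rV[F]_d}})
    (u : {vspace 'rV[F]_d} -> 'rV[F]_d) (x : 'rV[F]_d) :
  f (translate_measure S k Gamma u x) = translate_measure S' k Gamma u x.
Proof.
rewrite /translate_measure rmorphM fmorphV rmorphM rmorphXn !rmorph_nat rmorph_sum.
by congr (_ * _); apply: eq_bigr => V _; rewrite rmorph_nat.
Qed.

Lemma sum_character (R : realType) (F : finFieldType) (chi : F -> R[i]) :
  nontrivial_additive_character chi -> \sum_a chi a = 0.
Proof.
case=> _ chiD [b chib]; apply/eqP.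
have : (chi b - 1) * \sum_a chi a == 0.
  rewrite mulrBl mul1r subr_eq0 mulr_sumr [eqbRHS](reindex_inj (addrI b)) /=.
  by apply/eqP/eq_bigr => a _; rewrite chiD.
by rewrite mulf_eq0 subr_eq0 (negPf chib).
Qed.

(** The decay estimate with g(a) = chi(-a), B = 1 and c = 0, for the complex copy of the measure. *)
Lemma fourier_translate_measure (R : realType) (F : finFieldType) (n k : nat)
    (Gamma : {set {vspace 'rV[F]_n.+1}})
    (u : {vspace 'rV[F]_n.+1} -> 'rV[F]_n.+1) (chi : F -> R[i])
    (xi : 'rV[F]_n.+1) :
  Gamma \subset grassmannian F n.+1 k -> nontrivial_additive_character chi ->
  xi != 0 ->
  `|fourier chi (fun x => (translate_measure R k Gamma u x)%:C) xi| <=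
    #|Gamma|%:R^-1 * #|grassmannian F n k|%:R.
Proof.
move=> GammaG chiP xi0; have [chi1 _ _] := chiP.
have -> : fourier chi (fun x => (translate_measure R k Gamma u x)%:C) xi =
    \sum_x chi (- (0 + dotv xi x)) * translate_measure R[i] k Gamma u x.
  apply: eq_bigr => x _; rewrite add0r; congr (_ * _).
  exact: (rmorph_translate_measure (real_complex R)).
rewrite -[leRHS]mul1r.
apply: (translate_measure_decay u (g := fun a => chi (- a))) => // [|a].
  by rewrite -[RHS](sum_character chiP) [RHS](reindex_inj oppr_inj).
by rewrite chi1.
Qed.

(** * The lower bound for the size of K *)

Lemma card_grassmannian_le (S : numFieldType) (F : finFieldType) (n k : nat) :
  (0 < k <= n)%N ->
  #|grassmannian F n k|%:R <= 2 ^+ k * #|F|%:R ^+ (k * (n - k)) :> S.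
Proof.
move=> /andP[k0 kn]; have q0 : (0 < #|F|)%N := ltnW (finNzRing_gt1 F).
rewrite -!natrX -natrM ler_nat -(@leq_pmul2r (#|F| ^ (k * k))) ?expn_gt0 ?q0 //.
rewrite -mulnA -expnD -mulnDr subnK //.
exact: card_grassmannian_upper.
Qed.

(** Multiply the energy bound by the minimum m: m <= q^(n+1) handles the main term, and the other
    entry of the minimum, with |G(n,k)| <= 2^k q^(k(n-k)), bounds the error by 4^k. Hence the
    constant 1 + 4^k. *)
Lemma card_lower_bound (R : realType) (F : finFieldType) (n k : nat)
    (Gamma : {set {vspace 'rV[F]_n.+1}}) (K : {set 'rV[F]_n.+1})
    (u : {vspace 'rV[F]_n.+1} -> 'rV[F]_n.+1) :
  (0 < k <= n)%N -> Gamma \subset grassmannian F n.+1 k -> Gamma != set0 ->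
  (forall x, x \notin K -> translate_measure R k Gamma u x = 0) ->
  (1 + 4 ^+ k)^-1 * Num.min (#|F|%:R ^+ n.+1)
     (#|Gamma|%:R ^+ 2 * #|F|%:R ^- (2 * k * (n - k))) <= #|K|%:R :> R.
Proof.
move=> kn GammaG Gamma0 muK.
have := inv_card_le_l2 muK (sum_translate_measure1 R u GammaG Gamma0).
have := translate_measure_l2 R u GammaG Gamma0.
set s := \sum_x _.
have s0 : 0 <= s by apply: sumr_ge0 => x _; rewrite sqr_ge0.
have := card_grassmannian_le R F kn.
have -> : #|F|%:R ^+ (2 * k * (n - k)) = (#|F|%:R ^+ (k * (n - k))) ^+ 2 :> R.
  by rewrite -exprM; congr (_ ^+ _); lia.
have -> : 4 ^+ k = (2 ^+ k) ^+ 2 :> R by rewrite exprAC; congr (_ ^+ _); lra.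
have q0 : 0 < #|F|%:R :> R by rewrite ltr0n ltnW ?finNzRing_gt1.
have : 0 < #|F|%:R ^+ n.+1 :> R by rewrite exprn_gt0.
have : 0 < #|F|%:R ^+ (k * (n - k)) :> R by rewrite exprn_gt0.
have : 0 < #|Gamma|%:R :> R by rewrite ltr0n lt0n cards_eq0.
have : 0 <= #|K|%:R :> R by [].
have : 0 <= #|grassmannian F n k|%:R :> R by [].
have : 0 < 2 ^+ k :> R by rewrite exprn_gt0.
move: (#|F|%:R ^+ n.+1) (#|F|%:R ^+ (k * (n - k))) => D Q.
move: (2 ^+ k) #|Gamma|%:R #|K|%:R #|grassmannian F n k|%:R => t g K' G.
move=> t0 G0 K0 g0 Q0 D0 GQ l2 CS.
set m := Num.min _ _.
have mD : m <= D by rewrite ge_min lexx.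
have mg : m <= g ^+ 2 / Q ^+ 2 by rewrite ge_min lexx orbT.
have m0 : 0 <= m by rewrite le_min ltW //= divr_ge0 ?sqr_ge0.
have mG : m * (g^-1 * G) ^+ 2 <= t ^+ 2.
  apply: le_trans (ler_wpM2r (sqr_ge0 _) mg) _.
  have -> : g ^+ 2 / Q ^+ 2 * (g^-1 * G) ^+ 2 = (G / Q) ^+ 2.
    by field; rewrite !gt_eqF.
  by rewrite ler_pXn2r ?nnegrE ?divr_ge0 ?(ltW Q0) ?(ltW t0) // ler_pdivrMr.
have ms : m * s <= 1 + t ^+ 2.
  rewrite -(ler_pM2l D0) mulrCA.
  apply: le_trans (ler_wpM2l m0 l2) _.
  rewrite !mulrDr !mulr1 lerD // mulrCA ler_pM2l //.
have t1 : 0 < 1 + t ^+ 2 by rewrite ltr_pwDl ?sqr_ge0.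
rewrite mulrC ler_pdivrMr //.
rewrite -[m]mulr1; apply: le_trans (ler_wpM2l m0 CS) _.
by rewrite mulrCA ler_wpM2l.
Qed.

(** * Choice of translates and assembly of the estimates *)

Theorem theorem2p1 (R : realType) (d k : nat) (hk : (1 <= k)%N)
    (hkd : (k < d)%N) :
  exists c : R, 0 < c /\
  forall (F : finFieldType) (Gamma : {set {vspace 'rV[F]_d}})
    (K : {set 'rV[F]_d}),
  Gamma \subset grassmannian F d k ->
  contains_translates Gamma K ->
  (Gamma != set0 ->
   forall chi : F -> R[i], nontrivial_additive_character chi ->
   exists mu : 'rV[F]_d -> R, probability_measure_on K mu /\
     forall xi : 'rV[F]_d, xi != 0 ->
       `|fourier chi (fun x => (mu x)%:C) xi|
         <= (#|Gamma|%:R^-1 * #|grassmannian F d.-1 k|%:R : R[i])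
         <= #|F|%:R ^- k * (#|grassmannian F d k|%:R / #|Gamma|%:R)) /\
  c * Num.min (#|F|%:R ^+ d)
        (#|Gamma|%:R ^+ 2 * #|F|%:R ^- (2 * k * (d - k - 1)))
    <= #|K|%:R.
Proof.
case: d hkd => // n; rewrite ltnS => kn.
have k_n : (0 < k <= n)%N by rewrite hk.
(* The constant depends on [k] alone and is fixed before the field. *)
exists (1 + 4 ^+ k)^-1; split; first by rewrite invr_gt0 ltr_pwDl ?exprn_ge0.
move=> F Gamma K GammaG KGamma.
rewrite [(n.+1 - k - 1)%N](_ : _ = n - k)%N; last by lia.
(* For empty [Gamma] the minimum is 0. *)
have [->|Gamma0] := eqVneq Gamma set0.
  split=> //; rewrite cards0 expr0n mul0r.
  by rewrite (min_idPr _) ?exprn_ge0 // mulr0.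
have /fin_all_exists[u uP] : forall V : {vspace 'rV[F]_n.+1}, exists u : 'rV[F]_n.+1,
    V \in Gamma -> forall v, v \in V -> u + v \in K.
  move=> V; case: (boolP (V \in Gamma)) => [/KGamma[u uP]|_]; last by exists 0.
  by exists u.
have muK x : x \notin K -> translate_measure R k Gamma u x = 0.
  move=> xK; rewrite /translate_measure big1 ?mulr0 // => V VG.
  case: (boolP (_ \in V)) => // /(uP V VG).
  by rewrite addrC subrK (negPf xK).
split; last exact: card_lower_bound muK.
move=> _ chi chiP; exists (translate_measure R k Gamma u); split.
  split; [exact: translate_measure_ge0 | exact: sum_translate_measure1 |].
  by move=> x; apply: contraTT => /muK ->; rewrite ltxx.
move=> xi xi0; rewrite fourier_translate_measure //=.
have q0 : 0 < #|F|%:R :> R[i] by rewrite ltr0n ltnW ?finNzRing_gt1.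
(* Clearing denominators reduces the second inequality to the count of graphs of functionals. *)
rewrite mulrA mulrC ler_wpM2r ?invr_ge0 ?ler0n // ler_pdivlMl ?exprn_gt0 //.
by rewrite -natrX -natrM ler_nat mulnC card_grassmannian_step.
Qed.
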